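(* Consider a Weitzman-style sequential search process (as defined in the context) over a finite nonempty set of products $\mathcal{M}$, satisfying Independence and Invariance. Suppose the observed action sequence is: inspect products $1,2,\dots,J$ in this order ($J\ge 1$, $\{1,\dots,J\}=\mathcal{S}\subseteq\mathcal{M}$), then stop and purchase product $h\in\mathcal{S}$. Consider the consumer's ranking $\succ$ of all actions feasible at some stage of the process, namely $I_j$ (inspect $j$) for every $j\in\mathcal{M}$ and $P_j$ (purchase $j$) for every $j\in\mathcal{S}$. Then the search process is optimal if and only if, in this ranking, both of the following hold: 1. $I_1\succ I_2\succ\cdots\succ I_J$, and moreover $I_J\succ P_h$ if $h<J$; 2. every unselected action (every $I_k$ with $k\in\mathcal{M}\setminus\mathcal{S}$ and every $P_j$ with $j\in\mathcal{S}$, $j\ne h$) is ranked below the lower-ranked of $I_J$ and $P_h$.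
   Context: Model. Each product $j\in\mathcal{M}$ has a purchase value $u_j$, a real random variable with finite mean, cumulative distribution function $F_j$ and density $f_j$, initially unknown to the consumer, who knows $F_j$. By paying a search cost $c_j>0$ the consumer inspects $j$ and learns $u_j$. Only inspected products can be purchased, at most one product is purchased, and purchasing ends the process. Independence: the purchase values are independent across products, and inspecting a product reveals only its own purchase value. Invariance: inspections and purchases not yet carried out remain feasible at all later stages with the same search costs and purchase values. Reservation value. $z_j$ is the unique real solution $\bar u$ of $c_j=\int_{\bar u}^{\infty}(u-\bar u)\,dF_j(u)$. Bellman equation. For a finite set $R$ of uninspected products and a fallback value $\bar u\in\mathbb{R}$ (the largest purchase value found so far), let $W(\bar u,\emptyset)=\bar u$ and $$W(\bar u,R)=\max\Big\{\bar u,\ \max_{k\in R}\Big[-c_k+F_k(\bar u)\,W(\bar u,R\setminus\{k\})+\int_{\bar u}^{\infty}W(u,R\setminus\{k\})f_k(u)\,du\Big]\Big\}.$$ Optimal process. The realized values are fixed numbers $u_1,\dots,u_J$ (for the inspected products). The process ''inspect $1,\dots,J$ in order, then purchase $h$'' is optimal if each decision along it is optimal given the information then available: (i) product $1$ maximizes $-c_k+\int W(u,\mathcal{M}\setminus\{k\})f_k(u)\,du$ over $k\in\mathcal{M}$; (ii) for each $2\le t\le J$, inspecting $t$ attains the maximum in the Bellman equation at $\bar u=\max_{\ell<t}u_\ell$ and $R=\mathcal{M}\setminus\{1,\dots,t-1\}$; (iii) stopping attains the maximum in the Bellman equation at $\bar u=\max_{\ell\le J}u_\ell$ and $R=\mathcal{M}\setminus\mathcal{S}$,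 and $u_h=\max_{\ell\le J}u_\ell$. Ranking. The consumer ranks actions by their values: the value of $I_j$ is $z_j$ and the value of $P_j$ is the realized $u_j$; $a\succ b$ means that the value of $a$ exceeds that of $b$. It is assumed throughout that there are no ties: the numbers $z_j$ ($j\in\mathcal{M}$) and $u_j$ ($j\in\mathcal{S}$) are all distinct. *)

(* Defs.v *)
From HB Require Import structures.
From mathcomp Require Export all_boot all_order all_algebra.
From mathcomp Require Export all_classical all_reals all_analysis.
Set Implicit Arguments.
Unset Strict Implicit.
Unset Printing Implicit Defensive.
Import Order.TTheory GRing.Theory Num.Theory.
Import numFieldNormedType.Exports.
Local Open Scope ring_scope.

Section PurchaseValues.
Context {d : measure_display} {Omega : measurableType d} {R : realType}.
Variable P : probability Omega R.

Definition is_density (X : {RV P >-> R}) (f : R -> R) : Prop :=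
  [/\ measurable_fun [set: R]%classic f,
      forall x, 0 <= f x &
      forall A : set R, measurable A ->
        distribution P X A = (\int[lebesgue_measure]_(x in A) (f x)%:E)%E].

Definition mutually_independent (M : finType) (X : M -> {RV P >-> R}) : Prop :=
  forall (B : {set M}) (A : M -> set R),
    (forall j, measurable (A j)) ->
    P (\bigcap_(j in [set` B]) (X j @^-1` A j))%classic =
    (\prod_(j in B) P (X j @^-1` A j)%classic)%E.

Definition real_cdf (X : {RV P >-> R}) (x : R) : R := fine (cdf X x).

(* The integral with respect to dF is the one with respect to the law of X. *)
Definition is_reservation_value (X : {RV P >-> R}) (c z : R) : Prop :=
  c = \int[distribution P X]_(u in `[z, +oo[%classic) (u - z).

End PurchaseValues.

(* Costs c, distribution functions F and densities f are indexed by products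
   only: they do not change along the process, and inspecting k leaves the
   distributions of the other products unchanged. *)
Section Bellman.
Context {R : realType} {M : finType}.
Variables (c : M -> R) (F f : M -> R -> R).

(* V is the continuation value W(., S \ {k}), as a function of the fallback. *)
Definition inspection_value (V : R -> R) (ubar : R) (k : M) : R :=
  - c k + F k ubar * V ubar
  + \int[lebesgue_measure]_(u in `[ubar, +oo[%classic) (V u * f k u).

(* The recursion is on the number n of uninspected products; W_bellman below
   is the Bellman equation itself. *)
Fixpoint W_rec (n : nat) (ubar : R) (S : {set M}) : R :=
  if n is n'.+1 then
    \big[Num.max/ubar]_(k in S)
       inspection_value (fun u => W_rec n' u (S :\ k)) ubar k
  else ubar.

Definition W (ubar : R) (S : {set M}) : R := W_rec #|S| ubar S.

Lemma W_set0 (ubar : R) : W ubar finset.set0 = ubar.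
Proof. by rewrite /W cards0. Qed.

Lemma W_bellman (ubar : R) (S : {set M}) :
  W ubar S = \big[Num.max/ubar]_(k in S)
     inspection_value (fun u => W u (S :\ k)) ubar k.
Proof.
have [->|Sn0] := eqVneq S finset.set0; first by rewrite W_set0 big_set0.
rewrite /W -[in LHS](prednK (_ : 0 < #|S|)%N) ?card_gt0//=.
by apply: eq_bigr => k kS; rewrite (cardsD1 k S) kS.
Qed.

(* Value of inspecting k first, when there is no fallback yet. *)
Definition first_inspection_value (k : M) : R :=
  - c k + \int[lebesgue_measure]_u (W u ([set: M]%SET :\ k) * f k u).

Definition inspecting_attains (ubar : R) (S : {set M}) (k : M) : Prop :=
  k \in S /\ W ubar S = inspection_value (fun u => W u (S :\ k)) ubar k.

Definition stopping_attains (ubar : R) (S : {set M}) : Prop :=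
  W ubar S = ubar.

End Bellman.

(* A process with J = n.+1 inspections: p t is the product inspected at
   position t and u t its realized value. Positions are counted from 0, so
   that ord0 is the first inspection and ord_max the last one. *)
Section Process.
Context {R : realType} {M : finType} {n : nat}.

(* For 0 < t, the largest of the first t realized values. *)
Definition best_value (u : 'I_n.+1 -> R) (t : nat) : R :=
  \big[Num.max/u ord0]_(l < n.+1 | (l < t)%N) u l.

Definition uninspected (p : 'I_n.+1 -> M) (t : nat) : {set M} :=
  [set: M]%SET :\: [set p l | l : 'I_n.+1 & (l < t)%N]%SET.

Definition optimal_process (c : M -> R) (F f : M -> R -> R)
    (p : 'I_n.+1 -> M) (u : 'I_n.+1 -> R) (h : 'I_n.+1) : Prop :=
  [/\ forall k : M,
        first_inspection_value c F f k <= first_inspection_value c F f (p ord0),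
      forall t : 'I_n.+1, (0 < t)%N ->
        inspecting_attains c F f (best_value u t) (uninspected p t) (p t),
      stopping_attains c F f (best_value u n.+1) (uninspected p n.+1) &
      u h = best_value u n.+1].

End Process.

(* Purchases are indexed by positions in the inspection sequence, so the
   inhabitants of this type are exactly the actions feasible at some stage. *)
Inductive action (M : finType) (n : nat) :=
  | Inspect of M
  | Purchase of 'I_n.+1.
Arguments Inspect {M n} _.
Arguments Purchase {M n} _.

Section Ranking.
Context {R : realType} {M : finType} {n : nat}.
Variables (z : M -> R) (u : 'I_n.+1 -> R).

Definition action_value (a : action M n) : R :=
  match a with Inspect j => z j | Purchase t => u t end.

Definition ranked_above (a b : action M n) : Prop :=
  action_value b < action_value a.

Definition lower_ranked (a b : action M n) : action M n :=
  if action_value b < action_value a then b else a.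

Definition selected (p : 'I_n.+1 -> M) (h : 'I_n.+1) (a : action M n) : Prop :=
  match a with
  | Inspect j => exists t, j = p t
  | Purchase t => t = h
  end.

End Ranking.

(* Main.v *)
Require Import Defs.
From mathcomp Require Import all_boot all_order all_algebra.
From mathcomp Require Import all_classical all_reals all_analysis.
From mathcomp Require Import measurable_realfun lra.
Set Implicit Arguments.
Unset Strict Implicit.
Unset Printing Implicit Defensive.
Import Order.TTheory GRing.Theory Num.Theory.
Import numFieldNormedType.Exports.
Local Open Scope ring_scope.

(** Cap each purchase value at its reservation value, kappa_k = min(u_k, z_k).
    For a continuation value V that is nondecreasing and 1-Lipschitz, the
    definition of z_k gives
      - c_k + E[V (max (x, u_k))] <= E[V (max (x, kappa_k))],
    with equality if x <= z_k and V has slope 1 above z_k, and strictly if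
    z_k < x or V grows by strictly less than slope 1 above z_k. The operators
    V |-> E[V (max (., kappa_k))] commute by Fubini, so by induction
    W (x, S) = E[max (x, max_(k in S) kappa_k)]. The equality cases then say
    that inspecting k is optimal iff z_k is maximal in S and x <= z_k, and that
    stopping is optimal iff all z_k are at most x; what remains is order
    combinatorics. *)

(** * Nondecreasing 1-Lipschitz functions, the class of the continuation values *)

Definition slope01 {R : realType} (V : R -> R) : Prop :=
  forall x y, x <= y -> 0 <= V y - V x <= y - x.

Section Slope01.
Context {R : realType}.
Implicit Types V : R -> R.

Lemma slope01_id : slope01 (@id R).
Proof. by move=> x y xy; rewrite lexx andbT subr_ge0. Qed.

Lemma slope01_comp V V' : slope01 V -> slope01 V' -> slope01 (V \o V').
Proof.
move=> sV sV' x y xy /=; have /andP[V'0 V'1] := sV' _ _ xy.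
rewrite subr_ge0 in V'0; have /andP[-> VV'] := sV _ _ V'0.
exact: le_trans VV' V'1.
Qed.

Lemma slope01_max (a : R) : slope01 (Num.max a).
Proof. by move=> x y xy; case: (leP a x); case: (leP a y) => *; lra. Qed.

Lemma slope01_min (a : R) : slope01 (Num.min ^~ a).
Proof. by move=> x y xy; case: (leP x a); case: (leP y a) => *; lra. Qed.

Lemma slope01_homo V : slope01 V -> {homo V : x y / x <= y}.
Proof. by move=> sV x y /sV /andP[]; rewrite subr_ge0. Qed.

Lemma slope01_measurable V D : measurable D -> slope01 V -> measurable_fun D V.
Proof. by move=> mD sV; apply: nondecreasing_measurable => //; exact: slope01_homo. Qed.

(** At most linear growth: this is what makes such functions integrable under any law with finite
    mean. *)
Lemma slope01_norm V x : slope01 V -> `|V x| <= `|V 0| + `|x|.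
Proof.
move=> sV; have [/sV|/ltW/sV] := leP 0 x => /andP[? ?];
  by case: (ger0P (V 0)); case: (ger0P (V x)); case: (ger0P x) => *; lra.
Qed.

End Slope01.

(** * Expectations under a law with finite mean, and the reservation value *)

Section Expectation.
Context {R : realType} (nu : probability R R).
Hypothesis nu_mean : nu.-integrable [set: R]%classic (EFin \o @id R).
Implicit Types V phi : R -> R.

Lemma slope01_integrable V :
  slope01 V -> nu.-integrable [set: R]%classic (EFin \o V).
Proof.
move=> sV.
have : nu.-integrable [set: R]%classic
    (EFin \o (cst `|V 0| \+ (fun x : R => `|x|))).
  exact: (integrableD measurableT (finite_measure_integrable_cst _ _ _)
    (integrable_abse nu_mean)).
apply: le_integrable => //.
  by apply/measurable_EFinP; exact: slope01_measurable.
move=> x _ /=; rewrite lee_fin; apply: (le_trans (slope01_norm x sV)).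
exact: ler_norm.
Qed.

Lemma Rintegral_probability_cst (r : R) : \int[nu]_u r = r.
Proof. by rewrite Rintegral_cst// [X in fine X]probability_setT mulr1. Qed.

Lemma slope01_expectation (g : R -> R -> R) :
    (forall u, slope01 (g ^~ u)) -> (forall x, slope01 (g x)) ->
  slope01 (fun x => \int[nu]_u g x u).
Proof.
move=> g1 g2 x y xy.
have ig w := slope01_integrable (g2 w).
rewrite -RintegralB//; apply/andP; split.
  by apply: Rintegral_ge0 => u _; case/andP: (g1 u _ _ xy).
rewrite -[leRHS]Rintegral_probability_cst.
apply: le_Rintegral => //.
- by have := integrableB measurableT (ig y) (ig x); apply.
- exact: finite_measure_integrable_cst.
- by move=> u _; case/andP: (g1 u _ _ xy).
Qed.

Section Reservation.
Context (c z : R).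
Hypothesis c_gt0 : 0 < c.
Hypothesis cE : c = \int[nu]_(u in `[z, +oo[%classic) (u - z).

(** Since [u - min u z] is the positive part of [u - z], the cost is the mean loss from capping [u]
    at [z]. *)
Lemma reservation_costE : c = \int[nu]_u u - \int[nu]_u Num.min u z.
Proof.
rewrite -RintegralB//; last exact: slope01_integrable (slope01_min z).
rewrite cE Rintegral_mkcond; apply: eq_Rintegral => u _.
rewrite patchE mem_setE in_itv/= andbT.
(* The integrand restricted to [[z, +oo[] takes the default [point] elsewhere, which is 0 in [R]. *)
rewrite [point](_ : _ = 0 :> R)//.
by case: (leP u z) => zu; case: leP => ?; lra.
Qed.

(* Since c > 0, the value exceeds z with positive probability. *)
Lemma lt_expectation phi psi :
    nu.-integrable [set: R]%classic (EFin \o phi) ->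
    nu.-integrable [set: R]%classic (EFin \o psi) ->
    (forall u, phi u <= psi u) -> (forall u, z < u -> phi u < psi u) ->
  \int[nu]_u phi u < \int[nu]_u psi u.
Proof.
move=> iphi ipsi le_pp lt_pp; rewrite lt_neqAle le_Rintegral// andbT.
apply/eqP => eq_pp.
(* Equal means of ordered functions force them to agree almost everywhere. *)
have i0 : (\int[nu]_(u in [set: R]) `|(psi u - phi u)%:E| = 0)%E.
  rewrite (eq_integral (EFin \o (psi \- phi))); last first.
    by move=> u _; rewrite /= ger0_norm// subr_ge0.
  have ippsi : nu.-integrable [set: R]%classic (EFin \o (psi \- phi)).
    exact: integrableB ipsi iphi.
  rewrite -[LHS]fineK; last exact: integrable_fin_num.
  have := RintegralB measurableT ipsi iphi; rewrite eq_pp subrr.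
  by rewrite /Rintegral => ->.
have m_pp : measurable_fun [set: R]%classic (fun u => (psi u - phi u)%:E).
  exact: measurable_int (integrableB measurableT ipsi iphi).
have [N [mN N0 subN]] := (ae_eq_integral_abs nu measurableT m_pp).1 i0.
have : c = 0.
  rewrite cE /Rintegral (ae_eq_integral (cst 0%E)) ?integral0//.
    apply/measurable_EFinP; apply: measurable_funTS.
    exact: measurable_funB.
  exists N; split => // u /=.
  (* The integrand [u - z] vanishes at [u = z], so its nonzero points lie strictly above [z], where
     [phi < psi]; they all fall in the null set [N]. *)
  move/not_implyP; rewrite in_itv/= andbT => -[zu uz].
  apply: subN => /= /(_ I) [] /eqP.
  have : z < u.
    by rewrite lt_neqAle zu andbT; apply/eqP => zu'; apply: uz; rewrite zu' subrr.
  by move=> /lt_pp; rewrite -subr_gt0 => /gt_eqF ->.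
by move: c_gt0 => /gt_eqF/eqP.
Qed.

Section InspectionBounds.
Context (phi : R -> R).
Hypothesis phi01 : slope01 phi.

Let iphi := slope01_integrable phi01.
Let imin := slope01_integrable (slope01_min z).
Let iphimin := slope01_integrable (slope01_comp phi01 (slope01_min z)).
Let isum1 : nu.-integrable [set: R]%classic
  (EFin \o (fun u => phi u + Num.min u z)) := integrableD measurableT iphi imin.
Let isum2 : nu.-integrable [set: R]%classic
  (EFin \o (fun u => phi (Num.min u z) + u)) := integrableD measurableT iphimin nu_mean.

Let excess_le u : phi u + Num.min u z <= phi (Num.min u z) + u.
Proof.
have : Num.min u z <= u by rewrite ge_min lexx.
by move=> /phi01 /andP[_]; lra.
Qed.

(** Substituting the cost formula turns the gap between inspecting and capping into a difference of
    two means, whose integrands are compared pointwise by [excess_le]. The three lemmas below read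
    off its sign. *)
Let excessE : - c + \int[nu]_u phi u - \int[nu]_u phi (Num.min u z) =
  \int[nu]_u (phi u + Num.min u z) - \int[nu]_u (phi (Num.min u z) + u).
Proof.
rewrite (RintegralD _ iphi imin)// (RintegralD _ iphimin nu_mean)//.
by rewrite reservation_costE/=; lra.
Qed.

Lemma inspection_le :
  - c + \int[nu]_u phi u <= \int[nu]_u phi (Num.min u z).
Proof. by rewrite -subr_le0 excessE subr_le0; exact: le_Rintegral. Qed.

Lemma inspection_eq : (forall u, z <= u -> phi u - phi z = u - z) ->
  - c + \int[nu]_u phi u = \int[nu]_u phi (Num.min u z).
Proof.
move=> phi1; apply/eqP; rewrite -subr_eq0 excessE subr_eq0; apply/eqP.
apply: eq_Rintegral => u _; have [//|/ltW/phi1] := leP u z; lra.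
Qed.

Lemma inspection_lt : (forall u, z < u -> phi u - phi z < u - z) ->
  - c + \int[nu]_u phi u < \int[nu]_u phi (Num.min u z).
Proof.
move=> phi1; rewrite -subr_lt0 excessE subr_lt0; apply: lt_expectation => //.
by move=> u zu; have := phi1 _ zu; rewrite min_r ?ltW//; lra.
Qed.

End InspectionBounds.
End Reservation.
End Expectation.

(** * Change of variables from a density to its law *)

(* [measurableTypeR R] carries Lebesgue measure and [R] the laws of random
   variables: both have the Borel sets as measurable sets, but under different
   displays, so laws are transported along the identity below. *)
Section Density.
Context {R : realType} (nu : probability R R) (f : R -> R).
Hypothesis mf : measurable_fun [set: R]%classic f.
Hypothesis f_ge0 : forall x, 0 <= f x.
Hypothesis nuE : forall A : set R, measurable A ->
  nu A = (\int[lebesgue_measure]_(x in A) (f x)%:E)%E.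

Let idTR : R -> measurableTypeR R := idfun.

Let measurable_idTR : measurable_fun [set: R]%classic idTR.
Proof. by move=> _ A mA; rewrite setTI. Qed.

Let idTR_mfun := MeasurableFun.Pack (MeasurableFun.Class
  (isMeasurableFun.Build _ _ _ _ _ measurable_idTR)).

Let nu' := [the probability _ _ of distribution nu idTR_mfun].

Let nu'E (A : set (measurableTypeR R)) : measurable A ->
  nu' A = (\int[lebesgue_measure]_(x in A) (f x)%:E)%E.
Proof. exact: nuE. Qed.

Let nu'_dom : nu' `<< (@lebesgue_measure R).
Proof.
apply/null_content_dominatesP => A mA A0; rewrite nu'E//.
rewrite -[RHS](@integral_abs_eq0 _ _ _ lebesgue_measure A (EFin \o f)) //; last first.
  by apply/measurable_EFinP; exact: measurable_funTS.
by apply: eq_integral => x _; rewrite /= ger0_norm.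
Qed.

(** The law is absolutely continuous with respect to Lebesgue measure, and its Radon-Nikodym
    derivative coincides almost everywhere with [f]. *)
Lemma Rintegral_density (A : set R) (g : R -> R) : measurable A ->
    measurable_fun [set: R]%classic g -> nu.-integrable A (EFin \o g) ->
  \int[lebesgue_measure]_(x in A) (g x * f x) = \int[nu]_(x in A) g x.
Proof.
move=> mA mg ig; congr fine.
have mg' : measurable_fun [set: measurableTypeR R]%classic (EFin \o g).
  exact/measurable_EFinP.
have ig' : nu'.-integrable A (EFin \o g) by exact: integrable_pushforward.
rewrite -[RHS](integral_pushforward measurable_idTR mg' ig mA).
rewrite -[RHS](Radon_Nikodym_change_of_variables nu'_dom mA ig').
have mRN : measurable_fun A
    (Radon_Nikodym (charge_of_finite_measure nu') (@lebesgue_measure R)).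
  apply: measurable_funTS; apply: (measurable_int lebesgue_measure).
  exact: Radon_Nikodym_integrable.
have mfA : measurable_fun A (EFin \o f).
  by apply/measurable_EFinP; exact: measurable_funTS.
have mgA : measurable_fun A (EFin \o g) := measurable_int _ ig'.
apply: ae_eq_integral => //.
- exact: (emeasurable_funM mgA mfA).
- exact: (emeasurable_funM mgA mRN).
(* Both functions have the same integral, the mass under the law, over every measurable subset of
   [A]. *)
have : ae_eq lebesgue_measure A
    (Radon_Nikodym (charge_of_finite_measure nu') (@lebesgue_measure R)) (EFin \o f).
  apply: integral_ae_eq => //.
    apply: (integrableS measurableT) => //.
    exact: Radon_Nikodym_integrable.
  by move=> E EA mE; rewrite -Radon_Nikodym_integral//= nuE.
by apply: filterS => x /= /[apply] ->; rewrite EFinM.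
Qed.

End Density.

Section Law.
Context {d : measure_display} {Omega : measurableType d} {R : realType}.
Context (P : probability Omega R) (X : {RV P >-> R}) (f : R -> R).
Hypothesis X_density : is_density X f.
Local Notation law := (distribution P X : probability R R).
Let mf : measurable_fun [set: R]%classic f. Proof. by case: X_density. Qed.
Let f_ge0 x : 0 <= f x. Proof. by case: X_density. Qed.
Let lawE (A : set R) : measurable A ->
  law A = (\int[lebesgue_measure]_(x in A) (f x)%:E)%E.
Proof. by case: X_density => _ _; apply. Qed.

Lemma integrable_law : P.-integrable [set: Omega]%classic (EFin \o X) ->
  law.-integrable [set: R]%classic (EFin \o @id R).
Proof.
move=> iX; apply: integrable_pushforward => //; exact/measurable_EFinP.
Qed.

Hypothesis X_mean : P.-integrable [set: Omega]%classic (EFin \o X).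

(** Split the mean at [x]: below it the maximum is the constant [x], which contributes [F x * V x];
    above it the maximum is [u]. The two continuation terms of the Bellman equation thus become one
    expectation. *)
Lemma Rintegral_fallback (V : R -> R) (x : R) : slope01 V ->
  real_cdf X x * V x
  + \int[lebesgue_measure]_(u in `[x, +oo[%classic) (V u * f u) =
  \int[law]_u V (Num.max x u).
Proof.
move=> sV.
have iVmax := slope01_integrable (integrable_law X_mean)
  (slope01_comp sV (slope01_max x)).
have iV := slope01_integrable (integrable_law X_mean) sV.
have -> : \int[lebesgue_measure]_(u in `[x, +oo[%classic) (V u * f u) =
          \int[law]_(u in `]x, +oo[%classic) V (Num.max x u).
  (* The endpoint is Lebesgue-null; dropping it makes the ray disjoint from []-oo, x]]. *)
  transitivity (\int[lebesgue_measure]_(u in `]x, +oo[%classic) (V u * f u)).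
    congr fine; rewrite -integral_itv_obnd_cbnd//.
    apply/measurable_EFinP; apply: measurable_funTS.
    by apply: measurable_funM => //; exact: slope01_measurable.
  rewrite (Rintegral_density mf f_ge0 lawE)//;
  [|exact: slope01_measurable|exact: integrableS iV].
  apply: eq_Rintegral => u; rewrite inE/= in_itv/= andbT => /ltW xu.
  by rewrite max_r.
have -> : real_cdf X x * V x = \int[law]_(u in `]-oo, x]%classic) V (Num.max x u).
  rewrite mulrC -Rintegral_cst//; apply: eq_Rintegral => u.
  by rewrite inE/= in_itv/= => ux; rewrite max_l.
rewrite -Rintegral_setU//.
- congr (Rintegral _ _ _); apply/seteqP; split => // u _ /=.
  by rewrite !in_itv/= andbT; case: leP; [left|right].
- by apply: integrableS iVmax => //; exact: measurableU.
- by apply/disj_setPS => u [] /=; rewrite !in_itv/= andbT; case: leP.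
Qed.

End Law.

(** * Exchange of two expectations of a maximum *)

Section Fubini.
Context {R : realType} (nu1 nu2 : probability R R).
Hypothesis nu1_mean : nu1.-integrable [set: R]%classic (EFin \o @id R).
Hypothesis nu2_mean : nu2.-integrable [set: R]%classic (EFin \o @id R).

Lemma Rintegral_max_swap (V a b : R -> R) :
    slope01 V -> slope01 a -> slope01 b ->
  \int[nu1]_u \int[nu2]_v V (Num.max (a u) (b v)) =
  \int[nu2]_v \int[nu1]_u V (Num.max (a u) (b v)).
Proof.
move=> sV sa sb.
pose g (w : R * R) : \bar R := (V (Num.max (a w.1) (b w.2)))%:E.
have s1 v : slope01 (fun u => V (Num.max (a u) (b v))).
  apply: slope01_comp sV _ => x y xy /=; rewrite ![Num.max _ (b v)]maxC.
  exact: (slope01_comp (slope01_max (b v)) sa).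
have s2 u : slope01 (fun v => V (Num.max (a u) (b v))).
  exact: slope01_comp sV (slope01_comp (slope01_max (a u)) sb).
have mg : measurable_fun [set: R * R]%classic g.
  apply/measurable_EFinP; apply: (measurableT_comp (slope01_measurable measurableT sV)).
  apply: measurable_maxr.
    exact: (measurableT_comp (slope01_measurable measurableT sa) measurable_fst).
  exact: (measurableT_comp (slope01_measurable measurableT sb) measurable_snd).
have ig : (nu1 \x nu2)%E.-integrable [set: R * R]%classic g.
  (* Domination by [C + |u| + |v|]: the linear growth bound is applied to [V], then to [a] and [b],
     with [|max(s, t)| <= |s| + |t|] in between. *)
  pose C := `|V 0| + `|a 0| + `|b 0|.
  pose K := \int[nu2]_v `|v|.
  have norm1 : nu1.-integrable [set: R]%classic (EFin \o (fun u : R => `|u|)).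
    exact: integrable_abse nu1_mean.
  have norm2 : nu2.-integrable [set: R]%classic (EFin \o (fun u : R => `|u|)).
    exact: integrable_abse nu2_mean.
  have cst1 k := @finite_measure_integrable_cst _ _ _ nu1 _ k (@measurableT _ R).
  have cst2 k := @finite_measure_integrable_cst _ _ _ nu2 _ k (@measurableT _ R).
  have g_le u v : (`|g (u, v)| <= (C + `|u| + `|v|)%:E)%E.
    rewrite /g/= lee_fin (le_trans (slope01_norm _ sV))//.
    have := slope01_norm u sa; have := slope01_norm v sb.
    by rewrite /C; case: (leP (a u) (b v)) => _; move: (normr_ge0 (a u)) (normr_ge0 (b v));
      lra.
  have inner u : (\int[nu2]_v `|g (u, v)| <= (C + `|u| + K)%:E)%E.
    have i2 : nu2.-integrable [set: R]%classic (EFin \o (fun v => C + `|u| + `|v|)).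
      exact: (integrableD measurableT (cst2 (C + `|u|)) norm2).
    apply: (@le_trans _ _ (\int[nu2]_v (C + `|u| + `|v|)%:E)%E).
      apply: ge0_le_integral => //.
      - apply: measurableT_comp => //.
        by have := slope01_measurable measurableT (s2 u); move/measurable_EFinP.
      - exact: measurable_int i2.
    rewrite -[leLHS]fineK; last exact: integrable_fin_num.
    have := RintegralD measurableT (cst2 (C + `|u|)) norm2.
    rewrite Rintegral_probability_cst /Rintegral/= => ->.
    by rewrite lee_fin.
  apply/integrable12ltyP => //.
  have i1 : nu1.-integrable [set: R]%classic (EFin \o (fun u => C + K + `|u|)).
    exact: (integrableD measurableT (cst1 (C + K)) norm1).
  apply: (@le_lt_trans _ _ (\int[nu1]_u (C + K + `|u|)%:E)%E); last first.
    exact: integrable_lty i1.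
  apply: ge0_le_integral => //.
  - by move=> u _; exact: integral_ge0.
  - apply: (@measurable_fun_fubini_tonelli_F _ _ _ _ _ nu2 (abse \o g)) => //.
      exact: measurableT_comp.
    by move=> w; exact: abse_ge0.
  - exact: measurable_int i1.
  - by move=> u _; rewrite -addrA [K + _]addrC addrA.
have inner1 v : (\int[nu1]_u g (u, v) = (\int[nu1]_u V (Num.max (a u) (b v)))%:E)%E.
  by rewrite /Rintegral fineK//; apply: integrable_fin_num => //;
    exact: slope01_integrable.
have inner2 u : (\int[nu2]_v g (u, v) = (\int[nu2]_v V (Num.max (a u) (b v)))%:E)%E.
  by rewrite /Rintegral fineK//; apply: integrable_fin_num => //;
    exact: slope01_integrable.
congr fine; rewrite (eq_integral (fun u => \int[nu2]_v g (u, v))%E); last first.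
  by move=> u _; rewrite inner2.
by rewrite (Fubini ig); apply: eq_integral => v _; rewrite inner1.
Qed.

End Fubini.

(** * Expected maximum of the capped values *)

Section CappedValues.
Context {R : realType} {M : finType}.
Context (mu : M -> probability R R) (c z : M -> R).
Hypothesis mu_mean : forall k, (mu k).-integrable [set: R]%classic (EFin \o @id R).
Hypothesis c_gt0 : forall k, 0 < c k.
Hypothesis cE : forall k, c k = \int[mu k]_(u in `[z k, +oo[%classic) (u - z k).
Implicit Types (V : R -> R) (S : {set M}) (j k : M).

Definition capped k V (x : R) : R := \int[mu k]_u V (Num.max x (Num.min u (z k))).

(** This is [E[max(x, max_(k in S) kappa_k)]] written as an iterated integral. The order given by
    [enum] is immaterial because the operators commute. *)
Definition capped_max S : R -> R := foldr capped id (enum S).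

Let slope01_capped_arg V k x : slope01 V ->
  slope01 (fun u => V (Num.max x (Num.min u (z k)))).
Proof.
move=> sV; apply: slope01_comp sV _.
exact: slope01_comp (slope01_max x) (slope01_min (z k)).
Qed.

Lemma slope01_capped k V : slope01 V -> slope01 (capped k V).
Proof.
move=> sV; apply: slope01_expectation => // [u|x]; last exact: slope01_capped_arg.
move=> x y xy; rewrite ![Num.max _ (Num.min u _)]maxC.
exact: (slope01_comp sV (slope01_max _)) xy.
Qed.

Lemma capped_fixed k V x : z k <= x -> capped k V x = V x.
Proof.
move=> zx; transitivity (\int[mu k]_(u in [set: R]%classic) V x).
  apply: eq_Rintegral => u _; congr V; apply: max_l.
  by rewrite ge_min zx orbT.
exact: Rintegral_probability_cst.
Qed.

Lemma cappedC j k V : slope01 V -> capped j (capped k V) = capped k (capped j V).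
Proof.
move=> sV; apply/funext => x; rewrite /capped.
have sx i := slope01_comp (slope01_max x) (slope01_min (z i)).
(* Duplicating [x] by idempotence of the maximum separates the variables, giving the form
   [V (max (a u) (b v))] that Fubini requires. *)
have E i i' : \int[mu i]_u \int[mu i']_v
      V (Num.max (Num.max x (Num.min u (z i))) (Num.min v (z i'))) =
    \int[mu i]_u \int[mu i']_v
      V (Num.max (Num.max x (Num.min u (z i))) (Num.max x (Num.min v (z i')))).
  apply: eq_Rintegral => u _; apply: eq_Rintegral => v _; congr V.
  by rewrite maxACA maxxx -maxA.
rewrite !E (Rintegral_max_swap _ _ sV (sx j) (sx k))//.
by apply: eq_Rintegral => u _; apply: eq_Rintegral => v _; rewrite maxC.
Qed.

Let slope01_foldr s : slope01 (foldr capped id s).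
Proof. by elim: s => [|k s IH]; [exact: slope01_id|exact: slope01_capped]. Qed.

Let foldr_capped_rem k s : k \in s ->
  foldr capped id s = capped k (foldr capped id (rem k s)).
Proof.
elim: s => [//|j s IH]; rewrite inE => /= /predU1P[->|ks]; first by rewrite eqxx.
by case: eqVneq => [->//|_] /=; rewrite IH// cappedC.
Qed.

Let foldr_capped_perm s t : perm_eq s t -> foldr capped id s = foldr capped id t.
Proof.
elim: s t => [|k s IH] t; first by rewrite perm_sym => /perm_nilP ->.
move=> st; have kt : k \in t by rewrite -(perm_mem st) mem_head.
rewrite (foldr_capped_rem kt)/= (IH (rem k t))//.
by rewrite -(perm_cons k) (perm_trans st)// perm_to_rem.
Qed.

Lemma slope01_capped_max S : slope01 (capped_max S).
Proof. exact: slope01_foldr. Qed.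

Lemma capped_maxD1 S k : k \in S -> capped_max S = capped k (capped_max (S :\ k)).
Proof.
move=> kS; rewrite -[RHS]/(foldr capped id (k :: enum (S :\ k))).
apply: foldr_capped_perm; apply: uniq_perm => [||j].
- exact: enum_uniq.
- by rewrite /= enum_uniq mem_enum !inE eqxx.
- by rewrite inE !mem_enum !inE; case: eqVneq => [->|].
Qed.

Lemma capped_max_ge S x : x <= capped_max S x.
Proof.
rewrite /capped_max; elim: (enum S) x => [//|k s IH] x /=.
rewrite -[leLHS](Rintegral_probability_cst (mu k)).
apply: le_Rintegral => //.
- exact: finite_measure_integrable_cst.
- exact: slope01_integrable (slope01_capped_arg _ _ (slope01_foldr s)).
- by move=> u _; apply: le_trans (IH _); rewrite le_max lexx.
Qed.

Lemma capped_max_fixed S x : {in S, forall k, z k <= x} -> capped_max S x = x.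
Proof.
move=> zx; have : {in enum S, forall k, z k <= x}.
  by move=> k; rewrite mem_enum => /zx.
rewrite /capped_max; elim: (enum S) => [//|k s IH] /= zsx.
rewrite capped_fixed ?IH// => [j js|]; apply: zsx; rewrite inE ?eqxx//.
by rewrite js orbT.
Qed.

(** With positive probability [u] exceeds [z k], and then the capped value is [z k > x]. *)
Lemma capped_max_gt S k x : k \in S -> x < z k -> x < capped_max S x.
Proof.
move=> kS xz; rewrite (capped_maxD1 kS).
rewrite -[ltLHS](Rintegral_probability_cst (mu k)).
apply: (lt_expectation (c_gt0 k) (cE k)).
- exact: finite_measure_integrable_cst.
- exact: slope01_integrable (slope01_capped_arg _ _ (slope01_capped_max _)).
- by move=> u; apply: le_trans (capped_max_ge _ _); rewrite le_max lexx.
- move=> u zu; apply: lt_le_trans (capped_max_ge _ _).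
  by rewrite lt_max lt_min xz (lt_trans xz zu) orbT.
Qed.

(** When the capped value is [z k > x], which has positive probability, part of the increase from
    [x] to [y] is absorbed by the maximum; otherwise the gain is at most [y - x]. *)
Lemma capped_max_lt S k x y : k \in S -> x < z k -> x < y ->
  capped_max S y - capped_max S x < y - x.
Proof.
move=> kS xz xy; rewrite (capped_maxD1 kS); set V := capped_max _.
have sV : slope01 V := slope01_capped_max _.
have iV w := slope01_integrable (mu_mean k) (slope01_capped_arg k w sV).
have icst := @finite_measure_integrable_cst _ _ _ (mu k) _ (x - y) (@measurableT _ R).
have := RintegralD measurableT (iV y) icst.
rewrite Rintegral_probability_cst => E.
suff : capped k V y + (x - y) < capped k V x by rewrite /capped; lra.
rewrite -E; apply: (lt_expectation (c_gt0 k) (cE k)) => //.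
- exact: (integrableD measurableT (iV y) icst).
- move=> u /=; move: (Num.min u (z k)) => w.
  have /andP[] := slope01_max w (ltW xy); rewrite ![Num.max w _]maxC subr_ge0.
  by move=> /sV /andP[_]; lra.
- move=> u zu /=; rewrite min_r ?ltW//.
  have /andP[] := slope01_max (z k) (ltW xy); rewrite ![Num.max (z k) _]maxC subr_ge0.
  move=> /sV /andP[_]; rewrite (max_r (ltW xz)).
  by move: (z k) xz => w xz; case: (leP y w); lra.
Qed.

End CappedValues.

(** * Optimal decisions expressed by reservation values *)

Section Search.
Context {R : realType} {M : finType}.
Context (mu : M -> probability R R) (c z : M -> R) (F f : M -> R -> R).
Hypothesis mu_mean : forall k, (mu k).-integrable [set: R]%classic (EFin \o @id R).
Hypothesis c_gt0 : forall k, 0 < c k.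
Hypothesis cE : forall k, c k = \int[mu k]_(u in `[z k, +oo[%classic) (u - z k).
Hypothesis fallbackE : forall k V x, slope01 V ->
  F k x * V x + \int[lebesgue_measure]_(u in `[x, +oo[%classic) (V u * f k u) =
  \int[mu k]_u V (Num.max x u).
Hypothesis densityE : forall k V, slope01 V ->
  \int[lebesgue_measure]_u (V u * f k u) = \int[mu k]_u V u.
Implicit Types (V : R -> R) (S : {set M}) (j k : M).

Local Notation capped_max := (capped_max mu z).
Local Notation value := (inspection_value c F f).

Let s01 S : slope01 (capped_max S). Proof. exact: slope01_capped_max. Qed.

Lemma inspection_valueE V x k : slope01 V ->
  value V x k = - c k + \int[mu k]_u V (Num.max x u).
Proof. by move=> sV; rewrite /inspection_value -addrA fallbackE. Qed.

Lemma inspection_value_le V x k : slope01 V -> value V x k <= capped mu z k V x.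
Proof.
move=> sV; rewrite inspection_valueE//.
exact: (inspection_le (mu_mean k) (cE k) (slope01_comp sV (slope01_max x))).
Qed.

(** Above the largest reservation value the remaining products are worthless, so the continuation
    value is the identity there: the slope-1 equality case. *)
Lemma inspection_value_best S x k : k \in S -> x <= z k ->
    {in S, forall j, z j <= z k} ->
  value (capped_max (S :\ k)) x k = capped_max S x.
Proof.
move=> kS xz z_max; rewrite (capped_maxD1 z mu_mean kS) inspection_valueE//.
apply: (inspection_eq (mu_mean k) (cE k) (slope01_comp (s01 _) (slope01_max x))).
have top u : z k <= u -> capped_max (S :\ k) u = u.
  move=> zu; apply: capped_max_fixed => j; rewrite inE => /andP[_ jS].
  exact: le_trans (z_max _ jS) zu.
by move=> u zu /=; rewrite !max_r ?top// (le_trans xz).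
Qed.

Lemma inspection_value_lt S x k : k \in S ->
    z k < x \/ (exists2 j, j \in S & z k < z j) ->
  value (capped_max (S :\ k)) x k < capped_max S x.
Proof.
move=> kS bad; rewrite (capped_maxD1 z mu_mean kS) inspection_valueE//.
apply: (inspection_lt (mu_mean k) (c_gt0 k) (cE k)
  (slope01_comp (s01 _) (slope01_max x))) => u zu /=.
(* If [z k < x], the growth from [z k] to [u] is at most [max(x, u) - x], hence below [u - z k].
   Otherwise the product [j] still in [S :\ k] makes the slope less than 1. *)
have [zx|xz] := ltP (z k) x.
  have xu : Num.max x (z k) <= Num.max x u.
    by rewrite ge_max !le_max lexx/= (ltW zu) orbT.
  have /andP[_] := s01 (S :\ k) xu; rewrite (max_l (ltW zx)).
  by case: (leP x u); lra.
case: bad => [|[j jS zkj]]; first by rewrite ltNge xz.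
rewrite !max_r ?(le_trans xz (ltW zu))//.
apply: (capped_max_lt mu_mean c_gt0 cE (k := j)) => //.
by rewrite !inE jS andbT; apply: contraTneq zkj => ->; rewrite ltxx.
Qed.

(** By induction on the size of [S], each option is worth at most the capped maximum. The bound is
    attained by inspecting a product with maximal [z] if that is at least [x], and by stopping
    otherwise. *)
Lemma W_capped_max S : W c F f ^~ S = capped_max S.
Proof.
have [m] := ubnP #|S|; elim: m S => // m IH S mS.
have IHk k : k \in S -> W c F f ^~ (S :\ k) = capped_max (S :\ k).
  by move=> kS; apply: IH; move: mS; rewrite (cardsD1 k S) kS.
apply/funext => x; rewrite W_bellman.
under eq_bigr => k kS do rewrite IHk//.
apply/le_anti/andP; split.
  apply: bigmax_le => [|k kS]; first exact: capped_max_ge.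
  by rewrite (capped_maxD1 z mu_mean kS); exact: inspection_value_le.
have [->|[k0 k0S]] := set_0Vmem S.
  by rewrite big_set0 capped_max_fixed// => k; rewrite inE.
have [k kS z_max] := @arg_maxP _ _ _ k0 (mem S) z k0S.
have [xz|zx] := leP x (z k).
  rewrite -(inspection_value_best kS xz)//.
  exact: (@le_bigmax_cond _ _ _ x k (mem S)
    (fun k => value (capped_max (S :\ k)) x k)).
rewrite capped_max_fixed; first exact: bigmax_ge_id.
by move=> j jS; rewrite (le_trans (z_max _ jS))// ltW.
Qed.

Lemma inspecting_attainsP x S k : inspecting_attains c F f x S k <->
  [/\ k \in S, x <= z k & {in S, forall j, z j <= z k}].
Proof.
rewrite /inspecting_attains (congr1 (@^~ x) (W_capped_max S)) W_capped_max.
split=> [[kS E]|[kS xz z_max]]; last by rewrite inspection_value_best.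
split=> // [|j jS]; rewrite leNgt; apply/negP => lt_z.
  by have := inspection_value_lt (x := x) kS (or_introl lt_z); rewrite -E ltxx.
have := inspection_value_lt (x := x) kS (or_intror (ex_intro2 _ _ j jS lt_z)).
by rewrite -E ltxx.
Qed.

Lemma stopping_attainsP x S :
  stopping_attains c F f x S <-> {in S, forall k, z k <= x}.
Proof.
rewrite /stopping_attains (congr1 (@^~ x) (W_capped_max S)).
split=> [E k kS|]; last exact: capped_max_fixed.
rewrite leNgt; apply/negP => /(capped_max_gt mu_mean c_gt0 cE kS).
by rewrite E ltxx.
Qed.

(** The mean of the maximum of all capped values, without a fallback. It does not depend on [k], so
    it bounds every first inspection value. *)
Let first_value_bound k :=
  \int[mu k]_u capped_max ([set: M] :\ k) (Num.min u (z k)).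

Let first_value_boundE j k : first_value_bound j = first_value_bound k.
Proof.
have [->//|jk] := eqVneq j k.
have kD : k \in [set: M] :\ j by rewrite !inE eq_sym jk.
have jD : j \in [set: M] :\ k by rewrite !inE jk.
rewrite /first_value_bound (capped_maxD1 z mu_mean kD) (capped_maxD1 z mu_mean jD).
have -> : [set: M] :\ k :\ j = [set: M] :\ j :\ k.
  by apply/setP => i; rewrite !inE; case: (i == j); case: (i == k).
rewrite /capped (Rintegral_max_swap _ _ (s01 _) (slope01_min _) (slope01_min _))//.
by apply: eq_Rintegral => u _; apply: eq_Rintegral => v _; rewrite maxC.
Qed.

Let first_inspection_valueE k :
  first_inspection_value c F f k =
  - c k + \int[mu k]_u capped_max ([set: M] :\ k) u.
Proof.
rewrite -densityE//; congr (_ + _); apply: eq_Rintegral => u _.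
by rewrite (congr1 (@^~ u) (W_capped_max _)).
Qed.

(** The common bound is attained exactly by the products of maximal [z]. *)
Lemma first_inspectionP k0 :
  (forall k, first_inspection_value c F f k <= first_inspection_value c F f k0) <->
  (forall k, z k <= z k0).
Proof.
have best k : (forall j, z j <= z k) ->
    first_inspection_value c F f k = first_value_bound k.
  move=> z_max; rewrite first_inspection_valueE.
  apply: (inspection_eq (mu_mean k) (cE k) (s01 _)) => u zu.
  by rewrite !capped_max_fixed// => j _; rewrite (le_trans (z_max j)).
split=> [first_max k|z_max k]; last first.
  rewrite (best k0)// (first_value_boundE k0 k) first_inspection_valueE.
  exact: (inspection_le (mu_mean k) (cE k) (s01 _)).
rewrite leNgt; apply/negP => lt_z.
(* A maximizer [j] of [z] attains the bound, while [k0] misses it strictly because [k] has a larger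
   reservation value. *)
have [j _ z_max] := @arg_maxP _ _ _ k0 xpredT z isT.
have := first_max j; rewrite best => [|i]; last exact: z_max.
rewrite leNgt => /negP; apply; rewrite (first_value_boundE j k0) first_inspection_valueE.
apply: (inspection_lt (mu_mean k0) (c_gt0 k0) (cE k0) (s01 _)) => u zu.
apply: (capped_max_lt mu_mean c_gt0 cE (k := k)) => //.
by rewrite !inE andbT; apply: contraTneq lt_z => ->; rewrite ltxx.
Qed.

End Search.

(** * Order combinatorics: from optimality conditions to the ranking *)

Section Process.
Context {R : realType} {M : finType} {n : nat}.
Context (z : M -> R) (p : 'I_n.+1 -> M) (u : 'I_n.+1 -> R) (h : 'I_n.+1).
Local Notation last := (@ord_max n).

(** For [0 < t] the default [u ord0] of the big maximum is itself one of the first [t] values. *)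
Lemma best_value_leP (t : nat) (x : R) : (0 < t)%N ->
  best_value u t <= x <-> forall l : 'I_n.+1, (l < t)%N -> u l <= x.
Proof.
move=> t_gt0; rewrite /best_value; split=> [/bigmax_leP[_ //]|ux].
by apply: bigmax_le => // ; exact: ux.
Qed.

Lemma uninspectedP (t : nat) (j : M) : reflect
  (forall l : 'I_n.+1, (l < t)%N -> j != p l) (j \in uninspected p t).
Proof.
rewrite !inE andbT; apply: (iffP idP) => [jp l lt|jp].
  by apply: contra jp => /eqP ->; apply/imsetP; exists l; rewrite ?inE.
by apply/imsetP => -[l]; rewrite inE => /jp /eqP.
Qed.

Lemma ranked_above_lower (a b e : action M n) :
  ranked_above z u (lower_ranked z u a b) e <->
  ranked_above z u a e /\ ranked_above z u b e.
Proof.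
rewrite /ranked_above /lower_ranked.
have [ba|ab] := ltP (action_value z u b) (action_value z u a); split=> [eab|[]//].
  by split=> //; exact: lt_trans eab ba.
by split=> //; exact: lt_le_trans eab ab.
Qed.

Hypothesis p_inj : injective p.
Hypothesis no_ties : injective (@action_value R M n z u).

Let lt_no_ties (a b : action M n) : a <> b ->
  action_value z u a <= action_value z u b -> action_value z u a < action_value z u b.
Proof. by move=> ab le_ab; rewrite lt_neqAle le_ab andbT; apply/eqP => /no_ties. Qed.

(** Forwards, the absence of ties makes the weak inequalities strict. Backwards, the chain makes
    [z (p last)] the least inspected index, and every unselected action lies below both it and
    [u h]. *)
Lemma optimality_ranking :
  [/\ forall k, z k <= z (p ord0),
      forall t : 'I_n.+1, (0 < t)%N ->
        [/\ p t \in uninspected p t, best_value u t <= z (p t) &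
            {in uninspected p t, forall j, z j <= z (p t)}],
      {in uninspected p n.+1, forall k, z k <= best_value u n.+1} &
      u h = best_value u n.+1] <->
  ((forall s t : 'I_n.+1, t = s.+1 :> nat ->
      ranked_above z u (Inspect (p s)) (Inspect (p t))) /\
   ((h < last)%N -> ranked_above z u (Inspect (p last)) (Purchase h))) /\
  (forall a : action M n, ~ selected p h a ->
     ranked_above z u (lower_ranked z u (Inspect (p last)) (Purchase h)) a).
Proof.
split=> [[first_opt step_opt stop_opt uhE]|[[chain last_h] below]].
  have z_max (t : 'I_n.+1) j : j \in uninspected p t -> z j <= z (p t).
    have [t0|/step_opt[_ _]] := posnP t; last exact.
    by have -> : t = ord0 by apply: val_inj.
  have u_le_best l : u l <= best_value u n.+1.
    exact: (best_value_leP _ (ltn0Sn n)).1 (lexx _) l (ltn_ord l).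
  have u_le l : u l <= u h by rewrite uhE.
  (* The last inspection was optimal, so all values found before it are at most [z (p last)]. *)
  have u_last (l : 'I_n.+1) : (l < last)%N -> u l < z (p last).
    move=> lt_l; apply: (@lt_no_ties (Purchase l) (Inspect (p last))) => //=.
    have last_gt0 : (0 < last)%N := leq_ltn_trans (leq0n l) lt_l.
    have [_ best_le _] := step_opt _ last_gt0.
    exact: (best_value_leP _ last_gt0).1 best_le l lt_l.
  split; [split=> [s t ts|]|].
  - apply: (@lt_no_ties (Inspect (p t)) (Inspect (p s))) => /=.
      by case=> /p_inj ts'; move/eqP: ts; rewrite ts' eq_sym eqn_leq ltnn.
    apply: z_max; apply/uninspectedP => l ls; apply: contraTneq ls => /p_inj <-.
    by rewrite ts -leqNgt.
  - exact: u_last.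
  - move=> [k|l] unsel; apply/ranked_above_lower; rewrite /ranked_above/=.
      have k_unins (t : nat) : k \in uninspected p t.
        by apply/uninspectedP => l _; apply/eqP => kl; apply: unsel; exists l.
      split.
        apply: (@lt_no_ties (Inspect k) (Inspect (p last))) => [[kl]|/=].
          by apply: unsel; exists last.
        exact: z_max.
      apply: (@lt_no_ties (Inspect k) (Purchase h)) => //=.
      by rewrite uhE stop_opt.
    have lt_lh : u l < u h.
      by apply: (@lt_no_ties (Purchase l) (Purchase h)) => //= -[].
    split=> //; have [lt_l|ge_l] := ltnP l last; first exact: u_last.
    (* Now [l] is the last position, so [h] comes earlier and [u l < u h < z (p last)]. *)
    have le_n (i : 'I_n.+1) : (i <= n)%N by rewrite -ltnS.
    apply: (lt_trans lt_lh); apply: u_last; rewrite ltn_neqAle le_n andbT.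
    apply/eqP => hn; apply: unsel; apply: val_inj; rewrite /= hn.
    by apply/eqP; rewrite eqn_leq le_n.
have z_below k : (forall t, k <> p t) -> z k < z (p last) /\ z k < u h.
  move=> kp; apply: (ranked_above_lower (Inspect _) (Purchase _) (Inspect _)).1;
  apply: below => -[t].
  exact: kp.
have u_below l : l <> h -> u l < z (p last) /\ u l < u h.
  move=> lh; apply: (ranked_above_lower (Inspect _) (Purchase _) (Purchase _)).1.
  exact: below.
have chain_le (s t : 'I_n.+1) : (s <= t)%N -> z (p t) <= z (p s).
  have [m tE] : {m | m = t :> nat} by exists t.
  elim: m t tE => [|m IH] t tE; rewrite -tE.
    by rewrite leqn0 => /eqP s0; have -> : t = s by apply: val_inj; rewrite /= -tE s0.
  rewrite leq_eqVlt => /predU1P[sm|].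
    by have -> : t = s by apply: val_inj; rewrite /= -tE sm.
  rewrite ltnS => sm; have mn : (m < n.+1)%N by rewrite ltnW// tE.
  apply: le_trans (IH (Ordinal mn) erefl sm).
  by apply: ltW; apply: (chain (Ordinal mn) t); rewrite -tE.
have last_le t : z (p last) <= z (p t) by apply: chain_le; rewrite -ltnS.
have z_max (t : 'I_n.+1) j : j \in uninspected p t -> z j <= z (p t).
  move=> /uninspectedP jt.
  (* Either [j] is inspected at some [s >= t], and the chain applies, or it is never inspected and
     lies below [z (p last)]. *)
  have [/existsP[s /eqP js]|/existsPn jp] := boolP [exists s, j == p s].
    rewrite js; apply: chain_le; rewrite leqNgt; apply/negP => /jt.
    by rewrite js eqxx.
  have [lt_j _] := z_below j (fun s => elimN eqP (jp s)).
  exact: le_trans (ltW lt_j) (last_le t).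
have uhE : u h = best_value u n.+1.
  apply/le_anti/andP; split.
    exact: (best_value_leP _ (ltn0Sn n)).1 (lexx _) h (ltn_ord h).
  apply/best_value_leP => // l _; have [->//|/eqP lh] := eqVneq l h.
  by case: (u_below l lh) => _ /ltW.
split=> // [k|t t_gt0|k /uninspectedP k_unins].
- by apply: z_max; apply/uninspectedP.
- split; [|apply/best_value_leP => // l lt|exact: z_max].
    by apply/uninspectedP => l; apply: contraTneq => /p_inj ->; rewrite ltnn.
  (* If [l = h], then [h < t] is not the last position and [last_h] applies; otherwise [P_l] is
     unselected. *)
  apply: le_trans (last_le t); have [lh|/eqP lh] := eqVneq l h.
    rewrite lh; apply/ltW/last_h; rewrite -lh; apply: leq_trans lt _.
    by rewrite -ltnS.
  by case: (u_below l lh) => /ltW.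
- rewrite -uhE; have [] := z_below k; last by move=> _ /ltW.
  by move=> t; apply/eqP/k_unins.
Qed.

End Process.

(** * The characterization for purchase values with densities *)

Theorem theorem1 (R : realType) (d : measure_display)
  (Omega : measurableType d) (P : probability Omega R)
  (M : finType) (U : M -> {RV P >-> R}) (f : M -> R -> R) (c z : M -> R)
  (n : nat) (p : 'I_n.+1 -> M) (u : 'I_n.+1 -> R) (h : 'I_n.+1)
  (U_mean : forall j, P.-integrable [set: Omega]%classic (EFin \o U j))
  (U_density : forall j, is_density (U j) (f j))
  (U_indep : mutually_independent U)
  (c_gt0 : forall j, 0 < c j)
  (z_reservation : forall j, is_reservation_value (U j) (c j) (z j))
  (p_inj : injective p)
  (no_ties : injective (@action_value R M n z u)) :
  optimal_process c (fun j => real_cdf (U j)) f p u h <->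
  ((forall s t : 'I_n.+1, t = s.+1 :> nat ->
      ranked_above z u (Inspect (p s)) (Inspect (p t))) /\
   ((h < @ord_max n)%N ->
      ranked_above z u (Inspect (p ord_max)) (Purchase h))) /\
  (forall a : action M n, ~ selected p h a ->
     ranked_above z u
       (lower_ranked z u (Inspect (p ord_max)) (Purchase h)) a).
Proof.

have mean k := integrable_law (U_mean k).
have fallbackE k := Rintegral_fallback (U_density k) (U_mean k).
have densityE k V : slope01 V -> \int[lebesgue_measure]_x (V x * f k x) =
    \int[distribution P (U k)]_x V x.
  case: (U_density k) => mf f_ge0 lawE sV.
  apply: (@Rintegral_density _ (distribution P (U k) : probability R R)) => //.
    exact: slope01_measurable.
  exact: slope01_integrable.
rewrite -(optimality_ranking h p_inj no_ties) /optimal_process.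
have firstP := first_inspectionP mean c_gt0 z_reservation fallbackE densityE.
have inspectP := inspecting_attainsP mean c_gt0 z_reservation fallbackE.
have stopP := stopping_attainsP mean c_gt0 z_reservation fallbackE.
split=> -[/firstP first_opt step_opt /stopP stop_opt uhE]; split=> // t t_gt0.
  by apply/inspectP; exact: step_opt.
by apply/inspectP; exact: step_opt.
Qed.
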